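(* $\mathfrak{s}(\mathbb{R})\leq\max\{\mathfrak{b},\mathrm{non}(\mathcal{N})\}$.
   Context: $\mathfrak{b}$ is the bounding number (least size of a family of functions $\omega\to\omega$ unbounded modulo finite). $\mathrm{non}(\mathcal{N})$ is the least cardinality of a non-Lebesgue-measurable subset of $2^\omega$ (equivalently of $\mathbb{R}$). For infinite sets $U, A$, say $U$ splits $A$ if both $A\cap U$ and $A\setminus U$ are infinite. $\mathfrak{s}(\mathbb{R})$ is the smallest cardinality of a family $\mathcal{U}$ of open subsets of $\mathbb{R}$ (usual topology) such that every infinite $A\subseteq\mathbb{R}$ is split by some $U\in\mathcal{U}$. *)

(* Defs.v *)
From HB Require Import structures.
From mathcomp Require Import all_boot all_order all_algebra.
From mathcomp Require Import all_classical all_reals all_analysis.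
Set Implicit Arguments. Unset Strict Implicit. Unset Printing Implicit Defensive.
Import Order.TTheory GRing.Theory Num.Theory numFieldNormedType.Exports.
Local Open Scope classical_set_scope.
Local Open Scope ring_scope.

Definition le_star (f g : nat -> nat) : Prop :=
  exists N, forall n, (N <= n)%N -> (f n <= g n)%N.

(* F is unbounded modulo finite (the families whose least size is b) *)
Definition unbounded_family (F : set (nat -> nat)) : Prop :=
  ~ exists g : nat -> nat, forall f, F f -> le_star f g.

(* Lebesgue measurability on R: E differs from a Borel set by a
   subset of a Borel Lebesgue-null set (i.e. E is in the completion). *)
Definition lebesgue_measurable {R : realType} (E : set R) : Prop :=
  exists B : set (measurableTypeR R), measurable B /\
    (@lebesgue_measure R).-negligible ((E `\` B) `|` (B `\` E)).

Definition splits {T : Type} (U A : set T) : Prop :=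
  infinite_set (A `&` U) /\ infinite_set (A `\` U).

(* a splitting family of open subsets of R (witnesses for s(R)) *)
Definition open_splitting_family {R : realType} (UU : set (set R)) : Prop :=
  (forall U, UU U -> open U) /\
  (forall A : set R, infinite_set A -> exists2 U, UU U & splits U A).

(* Main.v *)
Require Import Defs.
From HB Require Import structures.
From mathcomp Require Import all_boot all_order all_algebra.
From mathcomp Require Import all_classical all_reals all_analysis.
From mathcomp Require Import zify ring lra.
Import Order.TTheory GRing.Theory Num.Theory numFieldNormedType.Exports.
Local Open Scope classical_set_scope.
Local Open Scope ring_scope.
Local Open Scope card_scope.

(* Let t be a random real.  At stage k, divide the line into cells of length
   1 / N and keep each cell with probability 2 ^- k.+2, independently, reading
   the choice for the j-th cell off the j-th digit of t in base 2 ^ k.+2.  A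
   given point lies in a kept cell with probability at most 2 ^- k.+1, whereas
   any sequence of distinct points is met with probability close to 1 as soon as
   N is large enough, say N >= g k, to separate many of its terms.  Let U f m t
   be the union over k >= m of the kept cells of mesh 1 / f k.  If f is not
   eventually dominated by g, then for almost every t every U f m t contains
   infinitely many terms of the sequence and some U f m t omits infinitely many.
   A non-null set contains such a t, so the sets U f m t with f in F, m in nat
   and t in X form a splitting family; its cardinality is bounded through
   Hessenberg's theorem. *)

(** * Cardinal comparison *)

Lemma card_leE (T : Type) (U : pointedType) (A : set T) (B : set U) :
  A #<= B <-> exists f : T -> U,
    (forall x, A x -> B (f x)) /\
    (forall x y, A x -> A y -> f x = f y -> x = y).
Proof.
split.
  move=> /pcard_leP; rewrite injfunPex => -[f fAB finj]; exists f; split => //.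
  by move=> x y Ax Ay; apply: finj; rewrite inE.
move=> [f [fAB finj]]; apply/pcard_leP; rewrite injfunPex.
by exists f => // x y; rewrite !inE; apply: finj.
Qed.

(** Zorn's lemma gives a maximal graph of a partial injection between [A] and [B]. If it missed a
    point on each side, adding that pair would enlarge it. *)
Lemma card_le_total (T U : pointedType) (A : set T) (B : set U) :
  A #<= B \/ B #<= A.
Proof.
pose P (G : set (T * U)) := [/\ (forall p, G p -> A p.1 /\ B p.2),
  (forall p q, G p -> G q -> p.1 = q.1 -> p = q) &
  (forall p q, G p -> G q -> p.2 = q.2 -> p = q)].
have [F FP totF|G [[GAB Gfun Ginj] Gmax]] := @Zorn_bigcup _ P.
  have pair p q : (\bigcup_(X in F) X) p -> (\bigcup_(X in F) X) q ->
      exists G, [/\ F G, G p & G q].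
    move=> [G FG Gp] [H FH Hq].
    by have [GH|HG] := totF _ _ FG FH; [exists H|exists G]; split => //;
      [exact: GH|exact: HG].
  split=> [p [G /FP[GAB _ _] /GAB//]|p q|p q] /pair /[apply] -[G []].
    by move=> /FP[_ + _]; apply.
  by move=> /FP[_ _]; apply.
have [AG|/existsNP[a /not_implyP[Aa aG]]] := pselect (forall a, A a -> exists b, G (a, b)).
  left; apply/card_leE.
  have /choice[f fP] : forall a, exists b, A a -> G (a, b).
    by move=> a; have [/AG[b]|] := pselect (A a); [exists b|exists point].
  exists f; split=> [x /fP/GAB[]//|x y /fP Gx /fP Gy fxy].
  by have [] := Ginj _ _ Gx Gy fxy.
have [BG|/existsNP[b /not_implyP[Bb bG]]] := pselect (forall b, B b -> exists a, G (a, b)).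
  right; apply/card_leE.
  have /choice[f fP] : forall b, exists a, B b -> G (a, b).
    by move=> b; have [/BG[c]|] := pselect (B b); [exists c|exists point].
  exists f; split=> [x /fP/GAB[]//|x y /fP Gx /fP Gy fxy].
  by have [] := Gfun _ _ Gx Gy fxy.
exfalso; apply: (Gmax (G `|` [set (a, b)])).
  split=> [p|/(_ (a, b)) abG]; first by left.
  by apply: aG; exists b; apply: abG; right.
split=> [p [/GAB//|->//]|p q|p q].
- move=> [Gp|->] [Gq|->] //=; first exact: Gfun.
    by case: p Gp => p1 p2 /= Gp e; case: aG; exists p2; rewrite -e.
  by case: q Gq => p1 p2 /= Gp e; case: aG; exists p2; rewrite e.
- move=> [Gp|->] [Gq|->] //=; first exact: Ginj.
    by case: p Gp => p1 p2 /= Gp e; case: bG; exists p1; rewrite -e.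
  by case: q Gq => p1 p2 /= Gp e; case: bG; exists p1; rewrite e.
Qed.

(* Hessenberg's theorem.  Zorn's lemma gives a maximal pair (D, h) with D an
   infinite subset of A and h an injection of D * D into D.  If A `\` D embeds
   in D, so does A and we are done; otherwise h extends to the union of D and a
   copy of D inside A `\` D. *)
Lemma infinite_setX_le (T : pointedType) (A : set T) :
  infinite_set A -> A `*` A #<= A.
Proof.
move=> Ainf.
pose good (p : set T * (T -> T -> T)) := [/\ p.1 `<=` A, infinite_set p.1,
  (forall x y, p.1 x -> p.1 y -> p.1 (p.2 x y)) &
  (forall x y x' y', p.1 x -> p.1 y -> p.1 x' -> p.1 y' ->
     p.2 x y = p.2 x' y' -> x = x' /\ y = y')].
(* The codes are compared only on the smaller set; they may differ outside it, so this is just a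
   preorder. *)
pose le (p q : {p | good p}) := (sval p).1 `<=` (sval q).1 /\
  forall x y, (sval p).1 x -> (sval p).1 y -> (sval p).2 x y = (sval q).2 x y.
pose R (p q : {p | good p}) := `[< le p q >].
(* A copy of the natural numbers inside [A], with their pairing function, is a first good pair; it
   also bounds the empty chain. *)
have [t0 _] : exists t : {p | good p}, True.
  have /infiniteP/card_leE[i [iA iinj]] := Ainf.
  have /choice[r rP] : forall x, exists n, range i x -> i n = x.
    move=> x; have [[n _ nx]|] := pselect (range i x); first by exists n.
    by exists 0%N.
  have iK n : r (i n) = n by apply: iinj => //; apply: rP; exists n.
  pose h x y := i (pickle (r x, r y)).
  suff g : good (range i, h) by exists (exist _ _ g).
  split=> /=.
  - by move=> _ [n _ <-]; apply: iA.
  - apply/infiniteP; apply/card_leE; exists i; split=> [n _|//].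
    by exists n.
  - by move=> x y _ _; exists (pickle (r x, r y)).
  - move=> _ _ _ _ [a _ <-] [b _ <-] [c _ <-] [d _ <-]; rewrite /h !iK.
    move=> /(iinj _ _ I I)/(pcan_inj pickleK).
    by case=> -> ->.
have [t|r s t|F totF|[[D h] gD] Dmax] := @ZL_preorder _ t0 R.
- by apply/asboolP; split.
- move=> /asboolP[rs rs'] /asboolP[st st']; apply/asboolP; split.
    exact: subset_trans st.
  by move=> x y rx ry; rewrite rs'// st'//; exact: rs.
- have [[p0 Fp0]|F0] := pselect (exists p, F p); last first.
    by exists t0 => s Fs; case: F0; exists s.
  have totF' p q : F p -> F q -> le p q \/ le q p.
    by move=> Fp Fq; have [/asboolP|/asboolP] := totF _ _ Fp Fq; [left|right].
  pose D x := exists2 p, F p & (sval p).1 x.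
  have D2 x p : D x -> F p -> exists q, [/\ F q, le p q & (sval q).1 x].
    move=> [q Fq qx] Fp; have [pq|qp] := totF' _ _ Fp Fq; first by exists q.
    exists p; split=> //; last exact: qp.1.
    by split.
  have /choice[h hP] : forall z : T * T, exists w, forall p, F p ->
      (sval p).1 z.1 -> (sval p).1 z.2 -> w = (sval p).2 z.1 z.2.
    move=> [x y] /=.
    have [[p [Fp px py]]|no] :=
      pselect (exists p, [/\ F p, (sval p).1 x & (sval p).1 y]); last first.
      by exists point => p Fp px py; case: no; exists p.
    exists ((sval p).2 x y) => q Fq qx qy.
    by have [[_ ->//]|[_ ->//]] := totF' _ _ Fp Fq.
  have g : good (D, fun x y => h (x, y)).
    split=> /=.
    + by move=> x [[p gp] Fp /= px]; case: (gp) => pA _ _ _; apply: pA.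
    + case: p0 Fp0 => p0 g0 Fp0; case: (g0) => _ + _ _.
      by apply: contra_not; apply: sub_finite_set => x px; exists (exist _ p0 g0).
    + move=> x y [p Fp px] /D2-/(_ p Fp)[q [Fq [pq _] qy]].
      rewrite (hP (x, y) q)//=; last exact: pq.
      exists q => //; case: q Fq pq qy => q gq /= _ pq qy.
      by case: (gq) => _ _ + _; apply=> //; exact: pq.
    + move=> x y x' y' [p Fp px] /D2-/(_ p Fp)[q [Fq [pq _] qy]].
      move=> /D2-/(_ q Fq)[r [Fr [qr _] rx']].
      move=> /D2-/(_ r Fr)[s [Fs [rs _] sy']].
      have sx : (sval s).1 x by apply/rs/qr/pq.
      have sy : (sval s).1 y by apply/rs/qr.
      have sx' : (sval s).1 x' by apply/rs.
      rewrite (hP (x, y) s)//= (hP (x', y') s)//=.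
      by case: s sx sy sx' sy' {Fs rs} => s gs /= *; case: (gs) => _ _ _; apply.
  exists (exist _ _ g) => p Fp; apply/asboolP; split=> /=.
    by move=> x px; exists p.
  by move=> x y px py; rewrite (hP (x, y) p).
case: (gD) => /= DA Dinf hD hinj.
(* Two distinct tags: through [h], pairing with [d0] or [d1] puts two disjoint copies of [D] inside
   [D]. *)
have [d0 [d1 [Dd0 Dd1 d01]]] : exists d0 d1, [/\ D d0, D d1 & d0 <> d1].
  have /infiniteP/card_leE[i [iD iinj]] := Dinf.
  exists (i 0%N), (i 1%N); split; [exact: iD|exact: iD|by move=> /iinj-/(_ I I)].
have [|] := card_le_total _ _ (A `\` D) D.
  move=> /card_leE[i [iD iinj]]; apply/card_leE.
  pose j x := if pselect (D x) then h x d0 else h (i x) d1.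
  have jD x : A x -> D (j x).
    by move=> Ax; rewrite /j; case: pselect => Dx; apply: hD => //; apply: iD.
  have jinj x y : A x -> A y -> j x = j y -> x = y.
    move=> Ax Ay; rewrite /j; case: pselect => Dx; case: pselect => Dy /hinj.
    - by case.
    - by case=> //; apply: iD.
    - by case=> //; [exact: iD|move=> _ /esym].
    - case=> //; [exact: iD|exact: iD|move=> + _].
      by apply: iinj; split.
  exists (fun z => h (j z.1) (j z.2)); split=> [z [z1 z2]|].
    by apply/DA/hD; apply: jD.
  move=> [x y] [x' y'] [/= Ax Ay] [/= Ax' Ay'] /hinj[]; try exact: jD.
  by move=> /jinj -> // /jinj -> //.
move=> /card_leE[e [eD einj]]; exfalso.
pose D' := D `|` e @` D.
have eND x : D x -> ~ D (e x) by move=> /eD[].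
have /choice[r rP] : forall x, exists y, (D x -> y = x) /\
    (~ D x -> D' x -> D y /\ e y = x).
  move=> x; have [Dx|nDx] := pselect (D x); first by exists x.
  have [[y Dy exy]|no] := pselect ((e @` D) x).
    by exists y; split.
  by exists point; split=> // _ [|].
have rD x : D' x -> D (r x).
  move=> D'x; have [Dx|nDx] := pselect (D x); first by rewrite (rP x).1.
  by have [] := (rP x).2 nDx D'x.
(* The tag tells which half of [D'] contains [x], so [r x] and [t x] together determine a point of
   [D']. *)
pose t x := if pselect (D x) then d0 else d1.
have tD x : D (t x) by rewrite /t; case: pselect.
have rtinj x y : D' x -> D' y -> r x = r y -> t x = t y -> x = y.
  move=> D'x D'y; rewrite /t; case: pselect => Dx; case: pselect => Dy rxy.
  - by move=> _; rewrite -((rP x).1 Dx) -((rP y).1 Dy).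
  - by [].
  - by move=> /esym.
  - by move=> _; rewrite -((rP x).2 Dx D'x).2 -((rP y).2 Dy D'y).2 rxy.
(* Pairs from [D] keep their code, so [h'] extends [h]. All other pairs of [D'] are coded in the
   image of [D] under [e], which is disjoint from [D], so the two kinds of values never collide. *)
pose h' x y := if pselect (D x /\ D y) then h x y
  else e (h (h (r x) (r y)) (h (t x) (t y))).
have cD x y : D' x -> D' y -> D (h (h (r x) (r y)) (h (t x) (t y))).
  by move=> D'x D'y; apply: (hD); apply: (hD) => //; exact: rD.
have g : good (D', h').
  split=> /=.
  - by move=> _ [/DA//|[y Dy <-]]; case: (eD y Dy).
  - by move=> /(sub_finite_set (fun x (Dx : D x) => or_introl Dx : D' x)).
  - move=> x y D'x D'y; rewrite /h'; case: pselect => [[Dx Dy]|n].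
      by left; apply: hD.
    by right; eexists; first exact: cD D'x D'y.
  - move=> x y x' y' D'x D'y D'x' D'y'; rewrite /h'.
    case: pselect => [[Dx Dy]|n]; case: pselect => [[Dx' Dy']|n'] /=.
    + exact: hinj.
    + move=> E; case: (eND _ (cD _ _ D'x' D'y')); rewrite -E; exact: hD.
    + move=> E; case: (eND _ (cD _ _ D'x D'y)); rewrite E; exact: hD.
    + move=> /einj-/(_ (cD _ _ D'x D'y) (cD _ _ D'x' D'y')).
      move=> /hinj[]; try by apply: (hD) => //; exact: rD.
      by move=> /hinj[]; try (exact: rD); move=> r1 r2 /hinj[] // t1 t2;
        split; exact: rtinj.
have /Dmax/asboolP[/= D'D _] : R (exist _ _ gD) (exist _ _ g).
  apply/asboolP; split=> /= [x|x y Dx Dy]; first by left.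
  by rewrite /h'; case: pselect => // -[].
by apply: (eND d0 Dd0); apply: D'D; right; exists d0.
Qed.

Lemma card_le_setX (T T' U U' : pointedType) (A : set T) (A' : set T')
    (B : set U) (B' : set U') :
  A #<= A' -> B #<= B' -> A `*` B #<= A' `*` B'.
Proof.
move=> /card_leE[f [fA finj]] /card_leE[g [gB ginj]]; apply/card_leE.
exists (fun p => (f p.1, g p.2)); split=> [p [p1 p2]|].
  by split; [exact: fA|exact: gB].
by move=> [x y] [x' y'] [/= Ax By] [/= Ax' By'] [/finj -> // /ginj -> //].
Qed.

(** By Hessenberg's theorem an infinite set absorbs any factor that embeds in it; the larger of [A]
    and [B] absorbs everything. *)
Lemma card_setX_nat_le (T U : pointedType) (A : set T) (B : set U) :
  infinite_set A -> infinite_set B ->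
  A `*` ([set: nat] `*` B) #<= A \/ A `*` ([set: nat] `*` B) #<= B.
Proof.
have absorb (V W : pointedType) (C : set V) (D : set W) : infinite_set C ->
    D #<= C -> D `*` C #<= C.
  move=> Cinf DC; apply: card_le_trans (infinite_setX_le _ _ Cinf).
  exact: card_le_setX.
move=> Ainf Binf; have natA := (infiniteP A).1 Ainf.
have natB := (infiniteP B).1 Binf; have := absorb _ _ _ _ Binf natB.
have [AB|BA] := card_le_total _ _ A B => natXB.
  right; apply: card_le_trans (absorb _ _ _ _ Binf AB).
  exact: card_le_setX.
left; apply: card_le_trans (infinite_setX_le _ _ Ainf).
by apply: card_le_setX => //; exact: card_le_trans natXB BA.
Qed.

(** * Outer measure bounds *)

(** Outer measure at most [e], witnessed by a measurable cover; the events below then never have to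
    be shown measurable. *)
Definition small {R : realType} (E : set R) (e : R) : Prop :=
  exists C : set (measurableTypeR R),
    [/\ measurable C, E `<=` C & (lebesgue_measure C <= e%:E)%E].

Section small_sets.
Context {R : realType}.
Implicit Types (E : set R) (e : R).

Lemma smallS E E' e : E `<=` E' -> small E' e -> small E e.
Proof. by move=> EE' [C [mC E'C Ce]]; exists C; split=> // x /EE' /E'C. Qed.

Lemma small_le E e e' : e <= e' -> small E e -> small E e'.
Proof.
move=> ee' [C [mC EC Ce]]; exists C; split => //.
by apply: le_trans Ce _; rewrite lee_fin.
Qed.

Lemma small0 : small (@set0 R) 0.
Proof. by exists set0; split => //; rewrite measure0. Qed.

Lemma smallU E E' e e' : small E e -> small E' e' -> small (E `|` E') (e + e').
Proof.
move=> [C [mC EC Ce]] [C' [mC' EC' Ce']]; exists (C `|` C'); split.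
- exact: measurableU.
- exact: setUSS.
- by apply: le_trans (measureU2 _ _ _) _ => //; rewrite EFinD leeD.
Qed.

Lemma small_seq (I : eqType) (s : seq I) (E : I -> set R) e :
  (forall i, small (E i) e) ->
  small [set x | exists2 i, i \in s & E i x] ((size s)%:R * e).
Proof.
move=> Ee; elim: s => [|i s IHs]; first by rewrite mul0r; apply: smallS small0 => x [].
rewrite /= -add1n natrD mulrDl mul1r; apply: smallS (smallU _ _ _ _ (Ee i) IHs).
move=> x [j]; rewrite inE => /predU1P[->|js] Ejx; [by left|by right; exists j].
Qed.

Lemma small_bigcup (E : nat -> set R) e : 0 <= e ->
  (forall k, small (E k) (e / (2 ^ k.+1)%:R)) -> small (\bigcup_k E k) e.
Proof.
move=> e0 /choice[C CP]; have mC k : measurable (C k) by have [] := CP k.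
exists (\bigcup_k C k); split.
- exact: bigcupT_measurable.
- by move=> x [k _ Ekx]; exists k => //; have [_ EC _] := CP k; apply: EC.
- apply: le_trans (measure_sigma_subadditive _ mC _ (@subset_refl _ _)) _.
    exact: bigcupT_measurable.
  apply: le_trans (epsilon_trick0 xpredT e0); apply: lee_nneseries => // k _.
  by have [] := CP k.
Qed.

(* The covers C n can be replaced by their tail intersections, which increase. *)
Lemma small_nondecreasing_bigcup (E : nat -> set R) e :
  (forall m n, (m <= n)%N -> E m `<=` E n) ->
  (forall n, small (E n) e) -> small (\bigcup_n E n) e.
Proof.
move=> ndE /choice[C CP].
pose D n := \bigcap_(m in [set m | (n <= m)%N]) C m.
have mC k : measurable (C k) by have [] := CP k.
have mD n : measurable (D n : set (measurableTypeR R)).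
  by apply: bigcap_measurable => //; exists n => /=.
have mUD : measurable (\bigcup_n D n : set (measurableTypeR R)).
  exact: bigcupT_measurable.
exists (\bigcup_n D n); split => //.
  move=> x [n _ Enx]; exists n => // m /= nm.
  by have [_ EC _] := CP m; apply: EC; apply: ndE Enx.
have ndD : nondecreasing_seq D.
  move=> m n mn; rewrite subsetEset => x Dx k /= nk; apply: Dx => /=.
  exact: leq_trans nk.
have cvgD := nondecreasing_cvg_mu (mu := lebesgue_measure) mD mUD ndD.
rewrite -(cvg_lim _ cvgD)//; apply: lime_le; first by apply/cvg_ex; eexists; exact: cvgD.
near=> n; have [_ _] := CP n; apply: le_trans.
by apply: le_measure; rewrite ?inE// => x /(_ n); apply => /=.
Unshelve. all: by end_near. Qed.

Lemma small_negligible E : (forall n, small E n.+1%:R^-1) ->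
  (@lebesgue_measure R).-negligible E.
Proof.
move=> /choice[C CP]; have mC k : measurable (C k) by have [] := CP k.
have mD : measurable (\bigcap_n C n : set (measurableTypeR R)).
  exact: bigcapT_measurable.
exists (\bigcap_n C n); split => //.
  apply/eqP; rewrite eq_le measure_ge0 andbT; apply/lee_addgt0Pr => e e0.
  have [n ne] : exists n, n.+1%:R^-1 <= e.
    exists (Num.truncn e^-1); rewrite invf_ple ?posrE//.
    by apply/ltW; exact: truncnS_gt.
  rewrite add0e; have [_ _ Cn] := CP n; apply: le_trans (le_trans Cn _).
    by apply: le_measure; rewrite ?inE// => x /(_ n I).
  by rewrite lee_fin.
by move=> x Ex n _; have [_ EC _] := CP n; apply: EC.
Qed.

Lemma small_itv (a b : R) : a <= b -> small `[a, b[%classic (b - a).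
Proof.
move=> ab; exists `[a, b[%classic; split => //.
by rewrite lebesgue_measure_itv /= lte_fin; case: ltP => // _; rewrite lee_fin subr_ge0.
Qed.

End small_sets.

(** * Independence of digits *)

(* Digits of the fractional part of t; digit 0 is the first one after the point. *)
Definition digit {R : realType} (B j : nat) (t : R) : nat :=
  (Num.truncn ((t - (Num.floor t)%:~R) * (B ^ j.+1)%:R) %% B)%N.

(* Truncations to L digits, as integers, of the numbers in [0, 1[ whose i-th
   digit lies in a i for every i < L. *)
Fixpoint prefixes (B : nat) (a : nat -> seq nat) (L : nat) : seq nat :=
  if L is L'.+1 then [seq (c * B + d)%N | c <- prefixes B a L', d <- a L']
  else [:: 0%N].

Section digits.
Context {R : realType}.
Implicit Types (t : R) (z : int) (B j : nat).

Lemma frac_bound t : 0 <= t - (Num.floor t)%:~R < 1.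
Proof. by have := floor_itv t; rewrite intrD1; lra. Qed.

(** Truncating one digit later multiplies the truncation by [B] and adds the new digit, which is the
    recursion defining [prefixes]. *)
Lemma mem_prefixes B a L t : (0 < B)%N -> (forall i, (i < L)%N -> digit B i t \in a i) ->
  Num.truncn ((t - (Num.floor t)%:~R) * (B ^ L)%:R) \in prefixes B a L.
Proof.
rewrite /digit; have /andP[] := frac_bound t.
move: (t - _) => u u0 u1 B0; elim: L => [_|L IHL ua] /=.
  by rewrite expn0 mulr1 inE; apply/eqP/truncn_def; rewrite u0.
apply/allpairsP; exists (Num.truncn (u * (B ^ L)%:R),
  (Num.truncn (u * (B ^ L.+1)%:R) %% B)%N) => /=.
split; [by apply: IHL => i iL; apply/ua/ltnW|exact: ua|].
rewrite {1}(divn_eq (Num.truncn (u * (B ^ L.+1)%:R)) B); congr (_ * _ + _)%N.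
apply/esym/truncn_def; set w := u * _; set q := Num.truncn w.
have w0 : 0 <= w by rewrite mulr_ge0.
have wE : w = (u * (B ^ L)%:R) * B%:R by rewrite /w expnSr natrM mulrA.
have B0' : 0 < B%:R :> R by rewrite ltr0n.
have /andP[qw wq] := truncn_itv w0.
apply/andP; split.
  rewrite -(ler_pM2r B0') -wE -natrM; apply: le_trans qw.
  by rewrite ler_nat leq_divM.
rewrite -(ltr_pM2r B0') -wE -natrM; apply: lt_le_trans wq _.
by rewrite ler_nat -/q; exact: ltn_ceil.
Qed.

Lemma size_prefixes B a L : size (prefixes B a L) = (\prod_(0 <= i < L) size (a i))%N.
Proof.
elim: L => [|L IHL] /=; first by rewrite big_geq.
by rewrite size_allpairs IHL big_nat_recr.
Qed.

(** Each prefix confines [t] to an interval of length [B ^ -L], and the number of prefixes is the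
    product of the sizes. Fixing the integer part [z] keeps the measure finite. *)
Lemma small_digits B (a : nat -> seq nat) L z : (0 < B)%N ->
  small [set t | Num.floor t = z /\ forall i, (i < L)%N -> digit B i t \in a i]
    (\prod_(0 <= i < L) ((size (a i))%:R / B%:R) : R).
Proof.
move=> B0.
have BL0 : 0 < (B ^ L)%:R :> R by rewrite ltr0n expn_gt0 B0.
pose I (c : nat) : set R :=
  `[z%:~R + c%:R / (B ^ L)%:R, z%:~R + c.+1%:R / (B ^ L)%:R[%classic.
have smallI c : small (I c) ((B ^ L)%:R^-1).
  apply: small_le (small_itv _ _ _); last first.
    by rewrite lerD2l ler_pM2r ?invr_gt0// ler_nat.
  by rewrite -[c.+1]addn1 natrD mulrDl mul1r; lra.
apply: smallS (small_le _ _ _ _ (small_seq _ (prefixes B a L) I _ smallI)).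
  move=> t [tz ta]; exists (Num.truncn ((t - (Num.floor t)%:~R) * (B ^ L)%:R)).
    exact: mem_prefixes.
  have /andP[t0 t1] := frac_bound t.
  have /truncn_itv : 0 <= (t - (Num.floor t)%:~R) * (B ^ L)%:R by rewrite mulr_ge0.
  rewrite tz; set n := Num.truncn _ => /andP[nl nr].
  rewrite /I /= in_itv /= addrC -lerBrDr ler_pdivrMr// nl /=.
  by rewrite addrC -ltrBlDr ltr_pdivlMr.
rewrite size_prefixes prodf_div prodr_const_nat subn0 natr_prod natrX.
by rewrite lexx.
Qed.

(** Positions outside [S] are allowed [B] values and contribute a factor 1, so only those in [S]
    count. *)
Lemma small_mem_digits B (S : pred nat) (b c : seq nat) L z r : (0 < B)%N -> size c = B ->
  (size b)%:R / B%:R = r ->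
  small [set t | Num.floor t = z /\ forall i, (i < L)%N ->
      digit B i t \in (if S i then b else c)]
    (\prod_(0 <= i < L | S i) r : R).
Proof.
move=> B0 cB br; apply: small_le (small_digits _ _ _ _ B0).
rewrite [leRHS]big_mkcond /=; rewrite le_eqVlt; apply/orP; left; apply/eqP/eq_bigr => i _.
case: (S i) => //.
by rewrite cB divff// pnatr_eq0 -lt0n.
Qed.

Lemma digit_lt B j t : (0 < B)%N -> (digit B j t < B)%N.
Proof. exact: ltn_pmod. Qed.

Lemma small_digit0 B j z : (0 < B)%N ->
  small [set t : R | Num.floor t = z /\ digit B j t = 0%N] B%:R^-1.
Proof.
move=> B0; apply: smallS (small_le _ _ _ _
  (small_mem_digits B (pred1 j) [:: 0%N] (iota 0 B) j.+1 z _ B0 (size_iota _ _) erefl)).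
  move=> t [tz tj]; split=> // i ij /=; case: eqP => [->|_]; first by rewrite tj.
  by rewrite mem_iota digit_lt.
rewrite big_mkcond big_nat_recr//= eqxx big1_seq ?mul1r// => i.
by rewrite mem_index_iota; case: eqP => // ->; rewrite ltnn andbF.
Qed.

Lemma small_digits_neq0 B (s : seq nat) z : (0 < B)%N -> uniq s ->
  small [set t : R | Num.floor t = z /\ forall j, j \in s -> digit B j t <> 0%N]
    ((B.-1%:R / B%:R) ^+ size s).
Proof.
move=> B0 us; pose L := (\max_(j <- s) j).+1.
apply: smallS (small_le _ _ _ _ (small_mem_digits B (mem s) (iota 1 B.-1) (iota 0 B)
  L z _ B0 (size_iota _ _) erefl)).
  move=> t [tz ts]; split=> // i _; case: ifPn => [/ts /eqP|_].
    rewrite -lt0n mem_iota => ->; rewrite add1n prednK// digit_lt//.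
  by rewrite mem_iota digit_lt.
rewrite -big_filter /= size_iota.
have p : perm_eq [seq i <- index_iota 0 L | i \in s] s.
  apply: uniq_perm => //; first by rewrite filter_uniq ?iota_uniq.
  move=> i; rewrite mem_filter mem_index_iota /=.
  by case: (boolP (i \in s)) => //= si; rewrite /L ltnS leq_bigmax_seq.
by rewrite (perm_big _ p)/= big_const_seq count_predT iter_mulr_1.
Qed.

End digits.

(** * Random open sets *)

(* Consecutive cells overlap, so that they can be open and still cover the
   half-line x >= - N. *)
Definition random_cells {R : realType} (k N : nat) (t : R) : set R :=
  [set x | exists2 j : nat, digit (2 ^ k.+2) j t = 0%N &
     j%:R - 1 < N%:R * (x + N%:R) < j%:R + 1].

(** Skipping the stages before [m] lowers the probability of containing a given point to at most
    [2 ^ -m]. *)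
Definition random_open {R : realType} (f : nat -> nat) (m : nat) (t : R) : set R :=
  \bigcup_(k in [set k | (m <= k)%N]) random_cells k (f k) t.

Lemma finite_range_tail {T : Type} (a : nat -> T) (S : set T) : injective a ->
  finite_set (range a `&` S) -> exists n0, forall n, (n0 <= n)%N -> ~ S (a n).
Proof.
move=> ainj /(finite_preimage (f := a)) fin.
have /finite_seqP[s Es] : finite_set (a @^-1` (range a `&` S)).
  by apply: fin => x y _ _; exact: ainj.
exists (\max_(i <- s) i).+1 => n + San; apply/negP; rewrite -leqNgt leq_bigmax_seq//.
by have : (a @^-1` (range a `&` S)) n; [split; [exists n|]|rewrite Es].
Qed.

Section random_open.
Context {R : realType}.
Implicit Types (t x : R) (z : int) (k m N : nat) (f : nat -> nat).

Lemma open_random_open f m t : open (random_open f m t).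
Proof.
apply: bigcup_open => k _.
have -> : random_cells k (f k) t = \bigcup_(j in [set j | digit (2 ^ k.+2) j t = 0%N])
    ((fun x => (f k)%:R * (x + (f k)%:R)) @^-1` `]j%:R - 1, j%:R + 1[%classic).
  by apply/seteqP; split=> x [j]; rewrite /= ?in_itv /=; exists j; rewrite //= in_itv.
apply: bigcup_open => j _; apply: open_comp; last exact: itv_open.
move=> x _; apply: cvgM; first exact: cvg_cst.
by apply: cvgD; [exact: cvg_id|exact: cvg_cst].
Qed.

Lemma small_random_cells k N x z :
  small [set t | Num.floor t = z /\ random_cells k N t x] ((2 ^ k.+1)%:R^-1).
Proof.
pose B := (2 ^ k.+2)%N; have B0 : (0 < B)%N by rewrite expn_gt0.
(* A cell containing [x] has index within distance 1 of [y], which leaves only [j0] and [j0.+1]. For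
   negative [y] the truncation is 0, and still no other index is possible. *)
pose y := N%:R * (x + N%:R); pose j0 := Num.truncn y.
apply: smallS (small_le _ _ _ _ (smallU _ _ _ _
  (small_digit0 B j0 z B0) (small_digit0 B j0.+1 z B0))).
  move=> t [tz [j tj /andP[]]]; rewrite -/y => jy yj.
  suff /orP[/eqP jE|/eqP jE] : (j == j0) || (j == j0.+1).
  - by left; split => //; rewrite -jE.
  - by right; split => //; rewrite -jE.
  have : (j < j0.+2)%N.
    by rewrite -(ltr_nat R) -addn1 natrD; have := truncnS_gt y; rewrite -/j0; lra.
  suff : (j0 <= j)%N by lia.
  by rewrite /j0 truncn_le_nat -addn1 natrD.
have B0' : (2 ^ k.+1)%:R != 0 :> R by rewrite pnatr_eq0 expn_eq0.
by rewrite /B expnS natrM -mulr2n le_eqVlt; apply/orP; left; apply/eqP; field.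
Qed.

Lemma small_random_open f m x z :
  small [set t | Num.floor t = z /\ random_open f m t x] ((2 ^ m)%:R^-1).
Proof.
apply: smallS (small_bigcup
  (fun k => [set t | Num.floor t = z /\ random_cells (m + k) (f (m + k)%N) t x]) _ _ _).
- move=> t [tz [k /= mk tk]]; exists (k - m)%N => //.
  by split=> //; rewrite subnKC.
- by rewrite invr_ge0.
- move=> k; apply: small_le (small_random_cells _ _ _ _).
  by rewrite -addnS expnD natrM invfM.
Qed.

(* For N large, finitely many of the points a n, n >= k, lie in distinct cells,
   so they are all missed with small probability. *)
Lemma small_miss_random_cells (a : nat -> R) k : injective a ->
  exists G, forall N z, (G <= N)%N ->
    small [set t | Num.floor t = z /\ forall n, (k <= n)%N -> ~ random_cells k N t (a n)]
      (k.+1%:R^-1).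
Proof.
move=> ainj; pose B := (2 ^ k.+2)%N; have B0 : (0 < B)%N by rewrite expn_gt0.
pose r : R := B.-1%:R / B%:R.
have B0' : 0 < B%:R :> R by rewrite ltr0n.
(* [M] is the number of points to separate: missing [M] distinct cells has probability [r ^+ M]. *)
have [M rM] : exists M, r ^+ M <= k.+1%:R^-1.
  have r1 : `|r| < 1.
    by rewrite ger0_norm ?divr_ge0// ltr_pdivrMr// mul1r ltr_nat ltn_predL.
  have k0 : 0 < k.+1%:R^-1 :> R by rewrite invr_gt0.
  have /cvgrPdist_le /(_ _ k0)[M _ /(_ M (leqnn M))] := cvg_expr r1.
  rewrite sub0r normrN; exists M; apply: le_trans (ler_norm _) _; exact.
pose s := iota k M.
(* With [N] above these bounds, [a i] lies in the covered half-line and distinct points are at least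
   [1 / N] apart, so their rescalings [y i] have distinct truncations. For [i = j] the inverse of 0
   is 0, which is harmless. *)
pose b i j := (Num.truncn `|a i| + Num.truncn (`|a i - a j|^-1)).+1.
pose G := (\max_(i <- s) \max_(j <- s) b i j)%N.
have bG i j : i \in s -> j \in s -> (b i j <= G)%N.
  move=> si sj; apply: leq_trans (leq_bigmax_seq (F := fun i => \max_(j <- s) b i j)%N i si isT).
  exact: (leq_bigmax_seq (F := fun j => b i j)).
exists G => N z GN; pose y i := N%:R * (a i + N%:R).
have bN i j : i \in s -> j \in s -> `|a i| <= N%:R /\ `|a i - a j|^-1 <= N%:R.
  move=> si sj; have := leq_trans (bG i j si sj) GN; rewrite /b => bN.
  by split; apply/ltW; (apply: lt_le_trans (truncnS_gt _) _); rewrite ler_nat;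
    apply: leq_trans bN; rewrite ltnS ?leq_addr ?leq_addl.
have y0 i : i \in s -> 0 <= y i.
  move=> si; have [+ _] := bN i i si si; rewrite ler_norml => /andP[aN _].
  by rewrite mulr_ge0//; lra.
have us : uniq [seq Num.truncn (y i) | i <- s].
  rewrite map_inj_in_uniq ?iota_uniq// => i j si sj ij; apply: ainj; apply/eqP.
  rewrite -subr_eq0; apply/negPn/negP => aij.
  have [_] := bN i j si sj; rewrite -[_^-1]mul1r ler_pdivrMr ?normr_gt0//.
  rewrite -[N%:R]ger0_norm// -normrM (_ : _ * _ = y i - y j); last by rewrite /y; ring.
  rewrite leNgt ltr_norml => /negP; apply.
  have := truncn_itv (y0 _ sj); have := truncn_itv (y0 _ si).
  by rewrite ij -addn1 natrD => /andP[i0 i1] /andP[j0 j1]; apply/andP; split; lra.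
apply: smallS (small_le _ _ _ rM _); last first.
  have := small_digits_neq0 B _ z B0 us.
  by rewrite size_map size_iota; apply.
move=> t [tz tk]; split=> // _ /mapP[i si ->] ti.
apply: (tk i); first by move: si; rewrite mem_iota => /andP[].
have /andP[y1 y2] := truncn_itv (y0 _ si).
exists (Num.truncn (y i)) => //; rewrite -/(y i).
by move: y2; rewrite -addn1 natrD => y2; apply/andP; split; lra.
Qed.

(** If no [m] works, then either some [random_open f m t] contains finitely many terms ([miss]), or
    every one of them omits finitely many ([hit]). Both events are null for each integer part. *)
Lemma negligible_not_split (a : nat -> R) : injective a ->
  exists g : nat -> nat, forall f, ~ le_star f g ->
    (@lebesgue_measure R).-negligible
      [set t | forall m, ~ splits (random_open f m t) (range a)].
Proof.
move=> ainj.
have /choice[g gP] := fun k => small_miss_random_cells a k ainj.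
exists g => f fg.
have often m : exists k, (m <= k)%N /\ (g k <= f k)%N.
  apply: contrapT => no; apply: fg; exists m => n mn.
  by rewrite leqNgt; apply/negP => gf; apply: no; exists n; split => //; exact: ltnW.
pose miss z k0 := [set t : R | Num.floor t = z /\ forall k, (k0 <= k)%N ->
  forall n, (k <= n)%N -> ~ random_cells k (f k) t (a n)].
(* There are arbitrarily late stages [k] with [g k <= f k], and each bounds the event by
   [1 / k.+1]. *)
have miss_null z k0 : (@lebesgue_measure R).-negligible (miss z k0).
  apply: small_negligible => n; have [k [nk gf]] := often (maxn n k0).
  move: nk; rewrite geq_max => /andP[nk k0k].
  apply: smallS (small_le _ _ _ _ (gP k (f k) z gf)).
    by move=> t [tz tk]; split=> // i ki; apply: tk.
  by rewrite lef_pV2 ?posrE// ler_nat.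
pose hit z m n0 := [set t : R | Num.floor t = z /\ forall n, (n0 <= n)%N ->
  random_open f m t (a n)].
(* The events increase with [n0], and each forces the single point [a n0] into the open set, so
   their union obeys the same bound [2 ^ -m]. *)
have hit_small z m : small (\bigcup_n0 hit z m n0) ((2 ^ m)%:R^-1).
  apply: small_nondecreasing_bigcup => [n n' nn' t [tz tn]|n].
    by split=> // i n'i; apply: tn; exact: leq_trans nn' n'i.
  by apply: smallS (small_random_open f m (a n) z) => t [tz tn]; split=> //; exact: tn.
have hit_null z : (@lebesgue_measure R).-negligible (\bigcap_m \bigcup_n0 hit z m n0).
  apply: small_negligible => m.
  apply: smallS (small_le _ _ _ _ (hit_small z m)); first by move=> t /(_ m I).
  by rewrite lef_pV2 ?posrE ?ltr0n ?expn_gt0// ler_nat ltn_expl.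
have null z : (@lebesgue_measure R).-negligible
    ((\bigcup_k0 miss z k0) `|` (\bigcap_m \bigcup_n0 hit z m n0)).
  by apply: negligibleU => //; exact: negligible_bigcup.
(* The integer parts are enumerated by pairing [Posz n] with [Negz n]. *)
apply: negligibleS (negligible_bigcup (fun n => negligibleU (null (Posz n)) (null (Negz n)))).
move=> t tm; pose E z := (\bigcup_k0 miss z k0) `|` (\bigcap_m \bigcup_n0 hit z m n0).
suff Et : E (Num.floor t) t.
  by case tz: (Num.floor t) Et => [n|n] Et; exists n => //; [left|right].
have [[m fin]|inf] := pselect (exists m, finite_set (range a `&` random_open f m t)).
  left; have [n0 n0P] := finite_range_tail _ _ ainj fin.
  exists (maxn m n0) => //; split=> // k; rewrite geq_max => /andP[mk n0k] n kn tn.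
  by apply: (n0P n (leq_trans n0k kn)); exists k.
right=> m _; have : finite_set (range a `\` random_open f m t).
  by apply: contrapT => inf'; apply: (tm m); split=> // fin; apply: inf; exists m.
rewrite setDE => /(finite_range_tail _ _ ainj)[n0 n0P]; exists n0 => //.
by split=> // n /n0P /contrapT.
Qed.

End random_open.

(* s(R) <= max{b, non(N)}, stated without cardinal objects: for every
   unbounded family F and every non-measurable X, there is a splitting
   family of open sets of size <= |F| or <= |X|. *)
Theorem theorem4p2 (R : realType) (F : set (nat -> nat)) (X : set R) :
  unbounded_family F -> ~ lebesgue_measurable X ->
  exists UU : set (set R), open_splitting_family UU /\
    ((UU #<= F) \/ (UU #<= X)).
Proof.
move=> Funb Xnmeas.
have Xnnull : ~ (@lebesgue_measure R).-negligible X.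
  move=> X0; apply: Xnmeas; exists set0; split => //.
  by rewrite setD0 set0D setU0.
have Xinf : infinite_set X.
  move=> Xfin; apply: Xnnull; apply/negligibleP;
    first exact/countable_measurable/finite_set_countable.
  exact/countable_lebesgue_measure0/finite_set_countable.
(* A finite family is dominated by its pointwise maximum. *)
have Finf : infinite_set F.
  move=> /finite_seqP[s Fs]; apply: Funb.
  exists (fun n => \max_(f <- s) f n)%N => f; rewrite Fs /= => sf.
  by exists 0%N => n _; exact: (leq_bigmax_seq (F := fun f : nat -> nat => f n)).
pose U (p : (nat -> nat) * (nat * R)) := random_open p.1 p.2.1 p.2.2.
exists (U @` (F `*` ([set: nat] `*` X))); split; last first.
  have [] := card_setX_nat_le _ _ _ _ Finf Xinf => le; [left|right];
    exact: card_le_trans (card_image_le _ _) le.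
split=> [_ [p _ <-]|A /infiniteP/card_leE[a [aA ainj]]]; first exact: open_random_open.
have {}ainj : injective a by move=> x y; exact: ainj.
have [g gP] := negligible_not_split a ainj.
have [f Ff fg] : exists2 f, F f & ~ le_star f g.
  apply: contrapT => no; apply: Funb; exists g => f Ff.
  by apply: contrapT => fg; apply: no; exists f.
have [t Xt [m [tI tD]]] : exists2 t, X t & exists m, splits (random_open f m t) (range a).
  apply: contrapT => no; apply: Xnnull; apply: negligibleS (gP f fg) => t Xt m tm.
  by apply: no; exists t => //; exists m.
(* A set that splits the sequence chosen inside [A] splits [A] as well. *)
have aA' : range a `<=` A by move=> _ [n _ <-]; exact: aA.
exists (random_open f m t); first by exists (f, (m, t)).
split; [apply: sub_infinite_set tI|apply: sub_infinite_set tD].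
  exact: setSI.
exact: setSD.
Qed.
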